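(* Let $G$ be a bridgeless cubic graph, and assume that $G$ admits a nowhere-zero $\mathbb{Z}_2^3$-flow $f$ such that there is a nonzero $\gamma\in \mathbb{Z}_2^3$ with $f^{-1}(\gamma)=\emptyset$. Then $G$ is $3$-edge-colorable.
   Context: Graphs are finite, undirected, without loops, possibly with parallel edges. $\mathbb{Z}_2^3$ is the elementary abelian group of order $8$. A nowhere-zero $\mathbb{Z}_2^3$-flow on $G$ is a map $f:E(G)\to\mathbb{Z}_2^3\setminus\{0\}$ such that, for some orientation of $G$, at every vertex the sum of the values on outgoing edges equals the sum of values on incoming edges (equivalently, since every element has order 2, the values on the edges incident with each vertex sum to $0$). *)

(* Defs.v *)
From mathcomp Require Import all_boot all_order all_algebra.

Set Implicit Arguments.
Unset Strict Implicit.
Unset Printing Implicit Defensive.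

Import GRing.Theory.
Local Open Scope ring_scope.

(* Parallel edges are distinct edges with the same set of ends; since this set
   has two elements, there are no loops. *)
Record multigraph := Multigraph {
  vertex : finType;
  edge : finType;
  ends : edge -> {set vertex};
  card_ends : forall e, #|ends e| = 2%N
}.

Definition degree (G : multigraph) (v : vertex G) : nat :=
  #|[set e : edge G | v \in ends e]|.

Definition cubic (G : multigraph) : Prop :=
  forall v : vertex G, degree v = 3%N.

(* Adjacency in the spanning subgraph of G with edge set A. *)
Definition adjacent (G : multigraph) (A : {set edge G}) : rel (vertex G) :=
  [rel u v | [exists e in A, ends e == [set u; v]]].

Definition num_components (G : multigraph) (A : {set edge G}) : nat :=
  n_comp (adjacent A) predT.

Definition bridge (G : multigraph) (e : edge G) : bool :=
  (num_components [set: edge G] < num_components (~: [set e]))%N.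

Definition bridgeless (G : multigraph) : Prop :=
  forall e : edge G, ~~ bridge e.

Record orientation (G : multigraph) := Orientation {
  tail : edge G -> vertex G;
  head : edge G -> vertex G;
  tail_head : forall e, ends e = [set tail e; head e]
}.

Definition nowhere_zero_flow (A : zmodType) (G : multigraph)
    (f : edge G -> A) : Prop :=
  (forall e, f e != 0) /\
  exists o : orientation G, forall v : vertex G,
    \sum_(e | tail o e == v) f e = \sum_(e | head o e == v) f e.

Definition proper_edge_coloring (k : nat) (G : multigraph)
    (c : edge G -> 'I_k) : Prop :=
  forall e1 e2 : edge G, e1 != e2 -> ends e1 :&: ends e2 != set0 ->
    c e1 != c e2.

Definition edge_colorable (k : nat) (G : multigraph) : Prop :=
  exists c : edge G -> 'I_k, proper_edge_coloring c.

(* Main.v *)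
Require Import Defs.
From mathcomp Require Import all_boot all_order all_algebra.

Import GRing.Theory.
Local Open Scope ring_scope.

(** Reducing the flow modulo <gamma> keeps it nowhere zero, since f takes
    neither of the values 0 and gamma, and the quotient has order 4. Three nonzero
    elements of Z_2^2 with sum 0 are distinct, so at the vertices of a cubic graph
    the reduced flow is a proper edge coloring by the three nonzero elements. *)

Lemma nowhere_zero_flow_comp (A B : zmodType) (g : {additive A -> B})
    (G : multigraph) (f : edge G -> A) :
  nowhere_zero_flow f -> (forall e, g (f e) != 0) -> nowhere_zero_flow (g \o f).
Proof.
move=> [_ [o flow_f]] gf_neq0; split=> //; exists o => v.
by rewrite /= -!raddf_sum flow_f.
Qed.

(** The two ends of an edge differ, so the edges at [v] split into those with tail [v] and those
    with head [v]. The two partial sums agree, and [x + x = 0] cancels them. *)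
Lemma flow_sum_incident (A : zmodType) (G : multigraph) (f : edge G -> A) v :
    (forall x : A, x + x = 0) -> nowhere_zero_flow f ->
  \sum_(e | v \in ends e) f e = 0.
Proof.
move=> addxx [_ [o flow_f]].
have tail_neq_head e : tail o e != Defs.head o e.
  by have := card_ends e; rewrite (tail_head o) cards2; case: eqP.
rewrite (bigID (fun e => tail o e == v)) /=.
rewrite (eq_bigl (fun e => tail o e == v)) => [|e]; last first.
  by rewrite (tail_head o) !inE (eq_sym v); case: (tail o e == v); rewrite ?andbF.
rewrite [X in _ + X](eq_bigl (fun e => Defs.head o e == v)) => [|e]; last first.
  have := tail_neq_head e; rewrite (tail_head o) !inE !(eq_sym v).
  case: (tail o e =P v) => [->|_] ne; last by rewrite andbT.
  by rewrite andbF eq_sym (negPf ne).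
by rewrite flow_f addxx.
Qed.

(** If two edges at a vertex had equal values, these would cancel, and the third edge there would
    have value 0. *)
Lemma edge_colorable_of_flow (A : finZmodType) (G : multigraph)
    (f : edge G -> A) :
    #|A| = 4%N -> (forall x : A, x + x = 0) -> cubic G -> nowhere_zero_flow f ->
  edge_colorable 3 G.
Proof.
move=> cardA addxx cubicG flow_f; have [f_neq0 _] := flow_f.
have card_neq0 : #|[set~ 0 : A]| = 3%N by rewrite cardsC1 cardA.
have f_in e : f e \in [set~ 0 : A] by rewrite !inE.
suff f_proper e1 e2 : e1 != e2 -> ends e1 :&: ends e2 != set0 -> f e1 != f e2.
  (* The color of [e] is the rank of [f e] among the three nonzero elements. *)
  exists (fun e => cast_ord card_neq0 (enum_rank_in (f_in e) (f e))).
  move=> e1 e2 ne12 meet12; apply: contra (f_proper e1 e2 ne12 meet12).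
  move=> /eqP/cast_ord_inj/(congr1 enum_val).
  by rewrite !enum_rankK_in // => ->.
move=> ne12 /set0Pn[v /setIP[v1 v2]]; apply/eqP => f12.
have := flow_sum_incident A G f v addxx flow_f.
rewrite (bigD1 e1) // (bigD1 e2) /=; last by rewrite v2 eq_sym.
rewrite addrA f12 addxx add0r => sum0.
have /eqP/cards1P[e3 /setP E3] : #|[set e | v \in ends e] :\ e1 :\ e2| = 1%N.
  have := cubicG v; rewrite /degree (cardsD1 e1) inE v1 (cardsD1 e2) !inE.
  by rewrite v2 eq_sym ne12 => -[].
have := f_neq0 e3; rewrite -sum0 (big_pred1 e3) ?eqxx // => e.
by have := E3 e; rewrite !inE => <-; rewrite andbC [(e != e1) && _]andbC.
Qed.

Theorem theorem8 (G : multigraph) (hcubic : cubic G) (hbridgeless : bridgeless G)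
  (hflow : exists f : edge G -> 'rV['F_2]_3,
     nowhere_zero_flow f /\
     exists gamma : 'rV['F_2]_3, gamma != 0 /\ f @^-1: [set gamma] = set0) :
  edge_colorable 3 G.
Proof.
have [f [flow_f [gamma [gamma_neq0 f_neq_gamma]]]] := hflow.
(* Multiplication by B is the quotient map modulo <gamma>. *)
pose B := col_base (cokermx gamma).
have kerB x : x *m B = 0 -> x = 0 \/ x = gamma.
  (* [B] is a left factor of [cokermx gamma], so [x *m B = 0] puts [x] in the row space of
     [gamma]. *)
  move=> xB0; have /sub_rVP[a ->] : (x <= gamma)%MS.
    by rewrite submxE -(mulmx_base (cokermx gamma)) mulmxA xB0 mul0mx.
  have [->|->] : a = 0 \/ a = 1.
    by case: a => -[|[|//]] lt_a; [left | right]; apply: val_inj.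
    by left; rewrite scale0r.
  by right; rewrite scale1r.
apply: (edge_colorable_of_flow _ _ (mulmxr B \o f)) hcubic _.
(* [B] has [\rank (cokermx gamma)] = 3 - 1 = 2 columns, whereas [cokermx gamma] has 3; hence the
   target has order 4. *)
- by rewrite card_mx card_Fp // mxrank_coker rank_rV gamma_neq0.
- move=> x; rewrite -mulr2n -scaler_nat.
  by rewrite (_ : 2%:R = 0 :> 'F_2) ?scale0r //; apply: val_inj.
apply: nowhere_zero_flow_comp => // e; apply/eqP => /kerB[fe|fe].
  by have [/(_ e)] := flow_f; rewrite fe eqxx.
by have := in_set0 e; rewrite -f_neq_gamma !inE fe eqxx.
Qed.
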